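(* Let $1\le p<\infty$ and let $d_{w,p}$ be a Lorentz sequence space. Let $J^{\ell_p}$ be the set of all operators $T\in L(d_{w,p})$ that factor through $\ell_p$, i.e. $T=BA$ for some $A\in L(d_{w,p},\ell_p)$ and $B\in L(\ell_p,d_{w,p})$. Then $J^{\ell_p}$ and its norm closure $\overline{J^{\ell_p}}$ are proper (two-sided) ideals in $L(d_{w,p})$.
   Context: Let $1\le p<\infty$ and let $w=(w_n)$ be a real sequence with $w_1=1$, $w_n\downarrow 0$ and $\sum_n w_n=\infty$. The Lorentz sequence space $d_{w,p}$ is the Banach space of all $x=(x_n)\in c_0$ with $\|x\|_{d_{w,p}}=\big(\sum_{n}w_n (x^*_n)^p\big)^{1/p}<\infty$, where $(x^*_n)$ is the non-increasing rearrangement of $(|x_n|)$. $L(X)$ denotes the algebra of bounded linear operators on $X$. An ideal in $L(X)$ is a linear subspace $J$ with $ATB\in J$ whenever $T\in J$, $A,B\in L(X)$; it is proper if $J\ne L(X)$. *)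

(* Defs.v *)
From HB Require Import structures.
From mathcomp Require Import all_boot all_order all_algebra.
From mathcomp Require Import all_classical all_reals all_analysis.
Set Implicit Arguments. Unset Strict Implicit. Unset Printing Implicit Defensive.
Import Order.TTheory GRing.Theory Num.Theory.
Import numFieldNormedType.Exports.
Local Open Scope classical_set_scope.
Local Open Scope ring_scope.

Section Lorentz.
Variable R : realType.

(* Sequences are indexed from 0; x_n of the paper is x (n-1). *)

(* Non-increasing rearrangement of (|x_k|)_k, for x in c_0:
   x*_n = inf { s >= 0 : #{k : |x_k| > s} <= n }  (0-indexed n). *)
Definition decr_rearr (x : nat -> R) (n : nat) : R :=
  inf [set s : R | 0 <= s /\
        exists2 F : seq nat, (size F <= n)%N & forall k, s < `|x k| -> k \in F].

Definition lorentz_sum (w : nat -> R) (p : R) (x : nat -> R) : \bar R :=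
  (\sum_(0 <= n <oo) ((w n * (decr_rearr x n) `^ p)%:E))%E.

Definition lorentz (w : nat -> R) (p : R) : set (nat -> R) :=
  [set x | x @ \oo --> (0 : R) /\ (lorentz_sum w p x < +oo)%E].

Definition lorentz_norm (w : nat -> R) (p : R) (x : nat -> R) : R :=
  (fine (lorentz_sum w p x)) `^ (p^-1).

Definition lp_sum (p : R) (x : nat -> R) : \bar R :=
  (\sum_(0 <= n <oo) ((`|x n| `^ p)%:E))%E.

Definition lp (p : R) : set (nat -> R) := [set x | (lp_sum p x < +oo)%E].

Definition lp_norm (p : R) (x : nat -> R) : R := (fine (lp_sum p x)) `^ (p^-1).

(* Operators are functions on sequences; only their values on the domain
   space matter. T is in L(X,Y) iff it maps X into Y, is linear on X and
   is bounded. *)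
Definition bounded_op (X : set (nat -> R)) (nX : (nat -> R) -> R)
    (Y : set (nat -> R)) (nY : (nat -> R) -> R)
    (T : (nat -> R) -> (nat -> R)) : Prop :=
  (forall x, X x -> Y (T x)) /\
  (forall (a : R) x y, X x -> X y ->
      T (fun k => a * x k + y k) = (fun k => a * T x k + T y k)) /\
  (exists C : R, forall x, X x -> nY (T x) <= C * nX x).

Definition op_ideal (X : set (nat -> R)) (nX : (nat -> R) -> R)
    (J : set ((nat -> R) -> (nat -> R))) : Prop :=
  (forall T, J T -> bounded_op X nX X nX T) /\
  J (fun _ _ => 0) /\
  (forall S T, J S -> J T -> J (fun x k => S x k + T x k)) /\
  (forall (a : R) T, J T -> J (fun x k => a * T x k)) /\
  (forall A T B, bounded_op X nX X nX A -> bounded_op X nX X nX B -> J T ->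
       J (fun x => A (T (B x)))).

Definition proper_op_ideal (X : set (nat -> R)) (nX : (nat -> R) -> R)
    (J : set ((nat -> R) -> (nat -> R))) : Prop :=
  op_ideal X nX J /\ exists T, bounded_op X nX X nX T /\ ~ J T.

Definition op_closure (X : set (nat -> R)) (nX : (nat -> R) -> R)
    (J : set ((nat -> R) -> (nat -> R))) : set ((nat -> R) -> (nat -> R)) :=
  [set T | bounded_op X nX X nX T /\
     forall eps : R, 0 < eps -> exists S, J S /\
        forall x, X x -> nX (fun k => T x k - S x k) <= eps * nX x].

Definition factor_lp (w : nat -> R) (p : R) : set ((nat -> R) -> (nat -> R)) :=
  [set T | bounded_op (lorentz w p) (lorentz_norm w p) (lorentz w p) (lorentz_norm w p) T /\
     exists A B,
       bounded_op (lorentz w p) (lorentz_norm w p) (lp p) (lp_norm p) A /\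
       bounded_op (lp p) (lp_norm p) (lorentz w p) (lorentz_norm w p) B /\
       forall x, lorentz w p x -> T x = B (A x)].

End Lorentz.

(* Main.v *)
Require Import Defs.
From HB Require Import structures.
From mathcomp Require Import all_boot all_order all_algebra.
From mathcomp Require Import all_classical all_reals all_analysis.
From mathcomp Require Import zify ring lra.
Import Order.TTheory GRing.Theory Num.Theory.
Import numFieldNormedType.Exports.
Local Open Scope classical_set_scope.
Local Open Scope ring_scope.

(* J is closed under sums because l_p (+) l_p is l_p.  If the closure of J
   contained the identity, some BA in J would be close to it, and A would be an
   isomorphic embedding of d_{w,p} into l_p.  Differences u_j = e_{m_j} - e_{n_j}
   of unit vectors with A u_j almost disjointly supported then satisfy
   |A (u_1 + ... + u_N)|^p >= d N, whereas |u_1 + ... + u_N|^p = w_1 + ... + w_{2N}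
   is o(N) since w tends to 0. *)

(** Differences take the place of weak convergence: all that is known of the vectors A e_n is that
    their coordinates are uniformly bounded, and a pigeonhole argument finds two that nearly agree
    on any finite set of coordinates, for p = 1 as for p > 1. The differences are chosen one at a
    time. Once z = u_1 + ... + u_N is fixed, A z has almost all its mass on finitely many
    coordinates, and the next u is taken with A u almost zero there. If c is the lower bound of the
    embedding, each step adds at least c^p / (2 * 2^p) to |A z|^p. The lost factor is harmless,
    because linear growth is compared with o(N); the same slack absorbs every quasi-norm
    constant. *)

(** * Nonnegative series and inequalities for p-th powers *)

Lemma nneseries_le_of_partial {R : realType} (u : nat -> R) (M : R) :
  (forall n, 0 <= u n) -> (forall N, \sum_(0 <= n < N) u n <= M) ->
  (\sum_(0 <= n <oo) (u n)%:E < +oo)%E /\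
  fine (\sum_(0 <= n <oo) (u n)%:E)%E <= M.
Proof.
move=> u0 uM.
have S0 : (0 <= \sum_(0 <= n <oo) (u n)%:E)%E.
  by apply: nneseries_ge0 => n _ _; rewrite lee_fin.
have SM : (\sum_(0 <= n <oo) (u n)%:E <= M%:E)%E.
  apply: lime_le.
    by apply: is_cvg_nneseries => n _ _; rewrite lee_fin.
  by apply: nearW => N; rewrite sumEFin lee_fin.
have Soo := le_lt_trans SM (ltry M).
by split=> //; rewrite -lee_fin fineK // ge0_fin_numE.
Qed.

Lemma partial_le_nneseries {R : realType} (u : nat -> R) (N : nat) :
  (forall n, 0 <= u n) -> (\sum_(0 <= n <oo) (u n)%:E < +oo)%E ->
  \sum_(0 <= n < N) u n <= fine (\sum_(0 <= n <oo) (u n)%:E)%E.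
Proof.
move=> u0 uoo.
have S0 : (0 <= \sum_(0 <= n <oo) (u n)%:E)%E.
  by apply: nneseries_ge0 => n _ _; rewrite lee_fin.
rewrite -lee_fin fineK ?ge0_fin_numE // -sumEFin.
by apply: nneseries_lim_ge => n _ _; rewrite lee_fin.
Qed.

Lemma ler_powR_base {R : realType} (p s t : R) :
  0 <= p -> 0 <= s -> s <= t -> s `^ p <= t `^ p.
Proof.
by move=> p0 s0 st; apply: ge0_ler_powR => //; rewrite nnegrE // (le_trans s0).
Qed.

Lemma powRK {R : realType} (p s : R) : p != 0 -> 0 <= s -> (s `^ p) `^ p^-1 = s.
Proof. by move=> p0 s0; rewrite -powRrM mulfV // powRr1. Qed.

Lemma powRVK {R : realType} (p s : R) : p != 0 -> 0 <= s -> (s `^ p^-1) `^ p = s.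
Proof. by move=> p0 s0; rewrite -powRrM mulVf // powRr1. Qed.

(** The sum is at most twice the larger term; no convexity enters, only monotonicity of the
    power. *)
Lemma powRD_le {R : realType} (p s t : R) : 0 <= p -> 0 <= s -> 0 <= t ->
  (s + t) `^ p <= 2 `^ p * (s `^ p + t `^ p).
Proof.
move=> p0; wlog st : s t / s <= t => [H s0 t0|s0 t0].
  by have [/H|/ltW/H] := leP s t; last rewrite addrC [s `^ p + _]addrC; apply.
apply: (@le_trans _ _ ((2 * t) `^ p)).
  by apply: ler_powR_base; lra.
by rewrite powRM // ler_wpM2l ?powR_ge0 // lerDr powR_ge0.
Qed.

Lemma normD_powR_le {R : realType} (p s t : R) : 0 <= p ->
  `|s + t| `^ p <= 2 `^ p * (`|s| `^ p + `|t| `^ p).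
Proof.
move=> p0; apply: le_trans (powRD_le p _ _ p0 (normr_ge0 s) (normr_ge0 t)).
by apply: ler_powR_base => //; exact: ler_normD.
Qed.

(** Turns an estimate between p-th power sums into a quasi-triangle inequality. With [s], [t] the
    p-th roots of [S], [T], both (|a| s)^p and t^p are at most (|a| s + t)^p, which costs the factor
    2. *)
Lemma powR_root_le {R : realType} (p K a S T Z : R) :
  0 < p -> 0 <= K -> 0 <= S -> 0 <= T -> 0 <= Z ->
  Z <= K * (`|a| `^ p * S + T) ->
  Z `^ p^-1 <= (2 * K) `^ p^-1 * (`|a| * S `^ p^-1 + T `^ p^-1).
Proof.
move=> p0 K0 S0 T0 Z0 ZK.
have pn : p != 0 by rewrite gt_eqF.
have pV0 : 0 <= p^-1 by rewrite invr_ge0 ltW.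
set s := S `^ p^-1; set t := T `^ p^-1.
have s0 : 0 <= s by exact: powR_ge0.
have t0 : 0 <= t by exact: powR_ge0.
have as0 : 0 <= `|a| * s by rewrite mulr_ge0.
rewrite -[X in _ * X](powRK p _ pn) ?addr_ge0 // -powRM ?powR_ge0 ?mulr_ge0 //.
apply: ler_powR_base => //; apply: (le_trans ZK).
rewrite [2 * K]mulrC -mulrA ler_wpM2l //.
have -> : S = s `^ p by rewrite powRVK.
have -> : T = t `^ p by rewrite powRVK.
rewrite -powRM // mulr_natl mulr2n lerD //.
- by apply: ler_powR_base; rewrite ?lerDl // ltW.
- by apply: ler_powR_base; rewrite ?lerDr // ltW.
Qed.

(** Each value h m occurs on the left for n = 2m and n = 2m+1, and both weights w n are at most w m.
    It pays for the halved indices in the rearrangement of a sum. *)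
Lemma sum_half_le {R : realType} (w h : nat -> R) (N : nat) :
  (forall n, w n.+1 <= w n) -> (forall n, 0 <= w n) -> (forall n, 0 <= h n) ->
  \sum_(0 <= n < N) w n * h n./2 <= 2 * \sum_(0 <= n < N) w n * h n.
Proof.
move=> wd w0 h0.
have wle m n : (m <= n)%N -> w n <= w m by move: m n; apply/nonincreasing_seqP.
(* With [N + N] terms on the left, each induction step adds exactly the two terms whose half is
   [N]. *)
suff H : \sum_(0 <= n < N + N) w n * h n./2 <= 2 * \sum_(0 <= n < N) w n * h n.
  apply: le_trans H; rewrite [leRHS](@big_cat_nat _ _ _ N) ?leq_addr //=.
  by rewrite lerDl sumr_ge0 // => i _; rewrite mulr_ge0.
elim: N => [|N IH]; first by rewrite !big_geq // mulr0.
rewrite addSn addnS !big_nat_recr //= uphalfE.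
have -> : ((N + N)./2 = N)%N by rewrite addnn doubleK.
have -> : ((N + N).+1./2 = N)%N by rewrite addnn -uphalfE uphalf_double.
have h1 : w (N + N)%N * h N <= w N * h N by rewrite ler_wpM2r // wle // leq_addr.
have h2 : w (N + N).+1 * h N <= w N * h N.
  by rewrite ler_wpM2r // wle // (leq_trans (leq_addr N N)).
by lra.
Qed.

(** * The decreasing rearrangement *)

Lemma decr_rearr_ge0 {R : realType} (x : nat -> R) (n : nat) :
  0 <= decr_rearr x n.
Proof.
rewrite /decr_rearr; set S := (X in inf X).
(* The infimum of the empty set is 0 by convention. *)
have [->|/set0P S0] := eqVneq S set0; first by rewrite inf0.
by apply: lb_le_inf => // s [].
Qed.

Lemma decr_rearr_le {R : realType} (x : nat -> R) (n : nat) (s : R) (F : seq nat) :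
  0 <= s -> (size F <= n)%N -> (forall k, s < `|x k| -> k \in F) ->
  decr_rearr x n <= s.
Proof.
move=> s0 Fn xF; apply: ge_inf; first by exists 0 => t [].
by split=> //; exists F.
Qed.

Lemma cvg0_bounded {R : realType} (x : nat -> R) :
  x @ \oo --> (0 : R) -> exists M, forall k, `|x k| <= M.
Proof.
move=> /cvg_norm /cvgP /cvg_seq_bounded /bounded_fun_has_ubound [M xM].
by exists M => k; apply: xM; exists k.
Qed.

(** The bound [M] makes the set of admissible levels nonempty, so that its infimum is approached by
    a level t < s; the gap between t and s turns the strict inequality of the definition into a weak
    one. *)
Lemma decr_rearr_lt {R : realType} (x : nat -> R) (n : nat) (M s : R) :
  (forall k, `|x k| <= M) -> decr_rearr x n < s ->
  exists2 F : seq nat, (size F <= n)%N & forall k, s <= `|x k| -> k \in F.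
Proof.
move=> xM /inf_lt[].
  exists M; split; first exact: le_trans (xM 0%N).
  by exists [::] => // k; rewrite ltNge xM.
move=> t [_ [F Fn xF]] ts; exists F => // k sk; apply: xF.
exact: lt_le_trans sk.
Qed.

Lemma norm_le_decr_rearr0 {R : realType} (x : nat -> R) (M : R) (k : nat) :
  (forall k, `|x k| <= M) -> `|x k| <= decr_rearr x 0.
Proof.
move=> xM; rewrite leNgt; apply/negP => /(decr_rearr_lt _ _ _ _ xM)[F].
by rewrite leqn0 => /nilP-> /(_ k (lexx _)).
Qed.

(** Outside the union of the two exceptional sets, of at most m + n indices, both sequences are
    small. *)
Lemma decr_rearrD_le {R : realType} (x y : nat -> R) (a M L : R) (m n k : nat) :
  (forall i, `|x i| <= M) -> (forall i, `|y i| <= L) -> (m + n <= k)%N ->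
  decr_rearr (fun i => a * x i + y i) k <=
    `|a| * decr_rearr x m + decr_rearr y n.
Proof.
move=> xM yL mnk; apply/ler_addgt0Pr => e e0.
(* Chosen so that |a| d + d = e. *)
pose d := e / (`|a| + 1).
have a1 : 0 < `|a| + 1 by rewrite ltr_wpDl.
have d0 : 0 < d by rewrite divr_gt0.
have [F Fm xF] := @decr_rearr_lt _ x m M (decr_rearr x m + d) xM
  (ltr_pwDr d0 (lexx _)).
have [G Gn yG] := @decr_rearr_lt _ y n L (decr_rearr y n + d) yL
  (ltr_pwDr d0 (lexx _)).
have -> : `|a| * decr_rearr x m + decr_rearr y n + e =
          `|a| * (decr_rearr x m + d) + (decr_rearr y n + d).
  by rewrite /d; field; rewrite gt_eqF.
apply: (@decr_rearr_le _ _ _ _ (F ++ G)).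
- by rewrite addr_ge0 ?mulr_ge0 // addr_ge0 ?decr_rearr_ge0 // ltW.
- by rewrite size_cat (leq_trans _ mnk) // leq_add.
move=> i; rewrite mem_cat; have [/xF->//|xi] := leP (decr_rearr x m + d) `|x i|.
have [/yG->|yi] := leP (decr_rearr y n + d) `|y i|; first by rewrite orbT.
rewrite ltNge (le_trans (ler_normD _ _)) // normrM lerD // ?ler_wpM2l //; exact: ltW.
Qed.

(** * The two sequence spaces as quasi-normed spaces *)

(* With a constant K in the triangle inequality both spaces can be treated by
   (s + t)^p <= 2^p (s^p + t^p); Minkowski's inequality is never needed. *)
Record quasi_norm {R : realType} (X : set (nat -> R)) (nX : (nat -> R) -> R) : Prop :=
  QuasiNorm {
    qn_zero : X (fun=> 0);
    qn_norm0 : nX (fun=> 0) = 0;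
    qn_ge0 : forall x, 0 <= nX x;
    qn_lin : forall (a : R) x y, X x -> X y -> X (fun k => a * x k + y k);
    qn_triangle : exists2 K : R, 0 <= K & forall (a : R) x y, X x -> X y ->
      nX (fun k => a * x k + y k) <= K * (`|a| * nX x + nX y) }.

Lemma decr_rearr_zero {R : realType} (n : nat) : decr_rearr (fun=> 0 : R) n = 0.
Proof.
apply/eqP; rewrite eq_le decr_rearr_ge0 andbT.
by apply: (@decr_rearr_le _ _ _ _ [::]) => // k; rewrite normr0 ltxx.
Qed.

Lemma quasi_norm_lp {R : realType} (p : R) : 1 <= p -> quasi_norm (lp p) (lp_norm p).
Proof.
move=> p1; have p0 : 0 < p by exact: lt_le_trans p1.
have pn : p != 0 by rewrite gt_eqF.
have z0 : lp_sum p (fun=> 0 : R) = 0%E.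
  by rewrite /lp_sum eseries0 // => n _ _; rewrite normr0 powR0.
have lin a x y : lp p x -> lp p y ->
    lp p (fun k => a * x k + y k) /\ fine (lp_sum p (fun k => a * x k + y k))
      <= 2 `^ p * (`|a| `^ p * fine (lp_sum p x) + fine (lp_sum p y)).
  move=> hx hy; apply: nneseries_le_of_partial => [n|N]; first exact: powR_ge0.
  apply: (@le_trans _ _ (2 `^ p * (`|a| `^ p * (\sum_(0 <= n < N) `|x n| `^ p)
      + \sum_(0 <= n < N) `|y n| `^ p))).
    rewrite mulr_sumr -big_split mulr_sumr /= ler_sum // => n _.
    by rewrite -powRM // -normrM normD_powR_le // ltW.
  rewrite ler_wpM2l ?powR_ge0 // lerD ?ler_wpM2l ?powR_ge0 //;
    by apply: partial_le_nneseries => // n; exact: powR_ge0.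
have S0 x : 0 <= fine (lp_sum p x).
  by rewrite fine_ge0 // nneseries_ge0 // => n _ _; rewrite lee_fin powR_ge0.
split; first by rewrite /lp /= z0 ltry.
- by rewrite /lp_norm z0 powR0 // invr_eq0.
- by move=> x; exact: powR_ge0.
- by move=> a x y hx hy; have [] := lin a x y hx hy.
exists ((2 * 2 `^ p) `^ p^-1) => [|a x y hx hy]; first exact: powR_ge0.
have [_ h] := lin a x y hx hy.
by apply: powR_root_le => //; exact: powR_ge0.
Qed.

(** Rearrangement is not subadditive index by index, so the value of (a x + y)* at n is compared
    with those of x* and y* at n/2; [sum_half_le] then returns to the index n at the cost of a
    factor 2. *)
Lemma quasi_norm_lorentz {R : realType} (w : nat -> R) (p : R) :
  1 <= p -> (forall n, w n.+1 <= w n) -> (forall n, 0 <= w n) ->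
  quasi_norm (lorentz w p) (lorentz_norm w p).
Proof.
move=> p1 wd w0; have p0 : 0 < p by exact: lt_le_trans p1.
have pn : p != 0 by rewrite gt_eqF.
have z0 : lorentz_sum w p (fun=> 0 : R) = 0%E.
  by rewrite /lorentz_sum eseries0 // => n _ _; rewrite decr_rearr_zero powR0 // mulr0.
have wp0 x n : 0 <= w n * decr_rearr x n `^ p by rewrite mulr_ge0 // powR_ge0.
have partial N x : (lorentz_sum w p x < +oo)%E ->
    \sum_(0 <= n < N) w n * decr_rearr x n `^ p <= fine (lorentz_sum w p x).
  by move=> hx; exact: (partial_le_nneseries _ N (wp0 x) hx).
have lin a x y : lorentz w p x -> lorentz w p y ->
    (lorentz_sum w p (fun k => a * x k + y k)%R < +oo)%E /\
    fine (lorentz_sum w p (fun k => a * x k + y k))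
      <= (2 * 2 `^ p) *
         (`|a| `^ p * fine (lorentz_sum w p x) + fine (lorentz_sum w p y)).
  move=> [/cvg0_bounded[M xM] hx] [/cvg0_bounded[L yL] hy].
  apply: nneseries_le_of_partial => [n|N]; first exact: wp0.
  pose h n := 2 `^ p * (`|a| `^ p * decr_rearr x n `^ p + decr_rearr y n `^ p).
  have h0 n : 0 <= h n by rewrite mulr_ge0 ?powR_ge0 // addr_ge0 ?mulr_ge0 ?powR_ge0.
  apply: (@le_trans _ _ (\sum_(0 <= n < N) w n * h n./2)).
    rewrite ler_sum // => n _; rewrite ler_wpM2l // /h -powRM ?decr_rearr_ge0 //.
    apply: le_trans (powRD_le _ _ _ (ltW p0) _ _);
      rewrite ?mulr_ge0 ?decr_rearr_ge0 //.
    apply: ler_powR_base; [exact: ltW | exact: decr_rearr_ge0 |].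
    by apply: (decr_rearrD_le _ _ _ M L) => //; lia.
  apply: (le_trans (sum_half_le _ _ _ wd w0 h0)); rewrite -mulrA ler_wpM2l //.
  apply: (@le_trans _ _ (2 `^ p * (`|a| `^ p * (\sum_(0 <= n < N) w n * decr_rearr x n `^ p)
      + \sum_(0 <= n < N) w n * decr_rearr y n `^ p))).
    rewrite mulr_sumr -big_split mulr_sumr /= ler_sum // => n _.
    by rewrite /h le_eqVlt; apply/orP; left; apply/eqP; ring.
  rewrite ler_wpM2l ?powR_ge0 // lerD //.
    by rewrite ler_wpM2l ?powR_ge0 // partial.
  by rewrite partial.
have S0 x : 0 <= fine (lorentz_sum w p x).
  by rewrite fine_ge0 // nneseries_ge0 // => n _ _; rewrite lee_fin.
split; first by split; [exact: cvg_cst | rewrite z0 ltry].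
- by rewrite /lorentz_norm z0 powR0 // invr_eq0.
- by move=> x; exact: powR_ge0.
- move=> a x y hx hy; have [h _] := lin a x y hx hy; split=> //.
  case: hx hy => [hx _] [hy _].
  have -> : 0 = a * 0 + 0 :> R by rewrite mulr0 addr0.
  by apply: cvgD hy; apply: cvgM hx; exact: cvg_cst.
exists ((2 * (2 * 2 `^ p)) `^ p^-1) => [|a x y hx hy]; first exact: powR_ge0.
have [_ h] := lin a x y hx hy.
by apply: powR_root_le => //; rewrite ?mulr_ge0 ?powR_ge0.
Qed.

(** * Bounded operators between quasi-normed sequence spaces *)

Section BoundedOperators.
Context {R : realType} {X Y : set (nat -> R)} {nX nY : (nat -> R) -> R}.
Hypotheses (qX : quasi_norm X nX) (qY : quasi_norm Y nY).

Lemma qn_scale (a : R) x : X x -> X (fun k => a * x k).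
Proof.
move=> hx; have := qn_lin _ _ qX a x (fun=> 0) hx (qn_zero _ _ qX).
by under eq_fun do rewrite addr0.
Qed.

Lemma qn_add x y : X x -> X y -> X (fun k => x k + y k).
Proof.
move=> hx hy; have := qn_lin _ _ qX 1 x y hx hy.
by under eq_fun do rewrite mul1r.
Qed.

Lemma qn_sub x y : X x -> X y -> X (fun k => x k - y k).
Proof.
move=> hx hy; have := qn_lin _ _ qX (-1) y x hy hx.
by under eq_fun do rewrite mulN1r addrC.
Qed.

Lemma qn_scale_le : exists2 K : R, 0 <= K & forall a x, X x ->
  nX (fun k => a * x k) <= K * `|a| * nX x.
Proof.
have [K K0 HK] := qn_triangle _ _ qX; exists K => // a x hx.
have := HK a x (fun=> 0) hx (qn_zero _ _ qX).
by under eq_fun do rewrite addr0; rewrite (qn_norm0 _ _ qX) addr0 mulrA.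
Qed.

Lemma qn_add_le : exists2 K : R, 0 < K & forall x y, X x -> X y ->
  nX (fun k => x k + y k) <= K * (nX x + nX y).
Proof.
(* [K + 1] is positive, and later estimates divide by this constant. *)
have [K K0 HK] := qn_triangle _ _ qX; exists (K + 1); first by rewrite ltr_wpDl.
move=> x y hx hy; have := HK 1 x y hx hy.
under eq_fun do rewrite mul1r; rewrite normr1 mul1r => h; apply: (le_trans h).
by rewrite ler_wpM2r ?lerDl // addr_ge0 // (qn_ge0 _ _ qX).
Qed.

Lemma bounded_op_ge0 T : bounded_op X nX Y nY T ->
  exists2 C : R, 0 <= C & forall x, X x -> nY (T x) <= C * nX x.
Proof.
move=> [_ [_ [C TC]]]; exists `|C| => // x hx; apply: (le_trans (TC x hx)).
by rewrite ler_wpM2r ?ler_norm // (qn_ge0 _ _ qX).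
Qed.

Lemma bounded_op_id : bounded_op X nX X nX id.
Proof. by split=> //; split=> //; exists 1 => x _; rewrite mul1r. Qed.

Lemma bounded_op_zero : bounded_op X nX Y nY (fun _ _ => 0).
Proof.
split=> [x _|]; first exact: (qn_zero _ _ qY).
split=> [a x y _ _|]; first by apply/funext => k; rewrite mulr0 addr0.
by exists 0 => x _; rewrite (qn_norm0 _ _ qY) mul0r.
Qed.

End BoundedOperators.

Section OperatorAlgebra.
Context {R : realType} {X Y : set (nat -> R)} {nX nY : (nat -> R) -> R}.
Hypotheses (qX : quasi_norm X nX) (qY : quasi_norm Y nY).

Lemma bounded_op_add S T : bounded_op X nX Y nY S -> bounded_op X nX Y nY T ->
  bounded_op X nX Y nY (fun x k => S x k + T x k).
Proof.
move=> [SY [Sl [C SC]]] [TY [Tl [D TD]]].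
split=> [x hx|]; first by apply: (qn_add qY); [exact: SY | exact: TY].
split=> [a x y hx hy|]; first by apply/funext => k; rewrite Sl // Tl //; ring.
have [K K0 HK] := qn_add_le qY; exists (K * (C + D)) => x hx.
apply: (le_trans (HK _ _ (SY x hx) (TY x hx))).
by rewrite -mulrA ler_wpM2l ?(ltW K0) // mulrDl lerD // ?SC // TD.
Qed.

Lemma bounded_op_scale (a : R) T : bounded_op X nX Y nY T ->
  bounded_op X nX Y nY (fun x k => a * T x k).
Proof.
move=> [TY [Tl [D TD]]].
split=> [x hx|]; first by apply: (qn_scale qY); exact: TY.
split=> [b x y hx hy|]; first by apply/funext => k; rewrite Tl //; ring.
have [K K0 HK] := qn_scale_le qY; exists (K * `|a| * D) => x hx.
apply: (le_trans (HK a _ (TY x hx))).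
by rewrite -[leRHS]mulrA ler_wpM2l ?TD // mulr_ge0.
Qed.

Lemma bounded_op_comp {Z : set (nat -> R)} {nZ} S T :
  bounded_op X nX Y nY T -> bounded_op Y nY Z nZ S ->
  bounded_op X nX Z nZ (fun x => S (T x)).
Proof.
move=> bT bS; have [D D0 TD] := bounded_op_ge0 qX _ bT.
have [C C0 SC] := bounded_op_ge0 qY _ bS.
case: bT bS => [TY [Tl _]] [SZ [Sl _]].
split=> [x hx|]; first by apply: SZ; exact: TY.
split=> [a x y hx hy|]; first by rewrite Tl // Sl //; exact: TY.
exists (C * D) => x hx; apply: (le_trans (SC _ (TY x hx))).
by rewrite -mulrA ler_wpM2l // TD.
Qed.

Lemma bounded_op_sub T x y : bounded_op X nX Y nY T -> X x -> X y ->
  T (fun k => x k - y k) = (fun k => T x k - T y k).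
Proof.
move=> [_ [Tl _]] hx hy; have := Tl (-1) y x hy hx.
under eq_fun do rewrite mulN1r addrC.
by under [X in _ = X -> _]eq_fun do rewrite mulN1r addrC.
Qed.

End OperatorAlgebra.

(** * The norm closure of an ideal *)

(** Approximants are combined as the operators are, with tolerances divided by the constants the
    operation costs: 2 K for a sum, K |a| for a multiple, C D for a composition. The last two may
    vanish, hence the added 1. *)
Lemma op_ideal_closure {R : realType} (X : set (nat -> R)) nX J :
  quasi_norm X nX -> op_ideal X nX J -> op_ideal X nX (op_closure X nX J).
Proof.
move=> qX [Jb [J0 [JD [JZ JM]]]]; split; first by move=> T [].
have nX0 := qn_ge0 _ _ qX.
split.
  split=> [|e e0]; first exact: bounded_op_zero.
  exists (fun _ _ => 0); split=> // x _.
  under eq_fun do rewrite subr0.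
  by rewrite (qn_norm0 _ _ qX) mulr_ge0 // ltW.
split.
  move=> S T [bS HS] [bT HT]; split=> [|e e0]; first exact: bounded_op_add.
  have [K K0 HK] := qn_add_le qX.
  have d0 : 0 < e / (2 * K) by rewrite divr_gt0 // mulr_gt0.
  have [S' [JS HS']] := HS _ d0; have [T' [JT HT']] := HT _ d0.
  exists (fun x k => S' x k + T' x k); split; first exact: JD.
  move=> x hx.
  have Xs : X (fun k => S x k - S' x k).
    by apply: (qn_sub qX); [apply bS | apply (Jb _ JS)].
  have Xt : X (fun k => T x k - T' x k).
    by apply: (qn_sub qX); [apply bT | apply (Jb _ JT)].
  under eq_fun do rewrite opprD addrACA.
  apply: (le_trans (HK _ _ Xs Xt)).
  have -> : e * nX x = K * (e / (2 * K) * nX x + e / (2 * K) * nX x).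
    by field; rewrite gt_eqF.
  by rewrite ler_wpM2l ?(ltW K0) // lerD // ?HS' // HT'.
split.
  move=> a T [bT HT]; split=> [|e e0]; first exact: bounded_op_scale.
  have [K K0 HK] := qn_scale_le qX.
  have Ka : 0 < K * `|a| + 1 by rewrite ltr_wpDl // mulr_ge0.
  have [T' [JT HT']] := HT _ (divr_gt0 e0 Ka).
  exists (fun x k => a * T' x k); split; first exact: JZ.
  move=> x hx.
  have Xt : X (fun k => T x k - T' x k).
    by apply: (qn_sub qX); [apply bT | apply (Jb _ JT)].
  under eq_fun do rewrite -mulrBr.
  apply: (le_trans (HK a _ Xt)).
  apply: (@le_trans _ _ ((K * `|a| + 1) * nX (fun k => T x k - T' x k))).
    by rewrite ler_wpM2r // lerDl.
  by rewrite mulrC -ler_pdivlMr // mulrAC HT'.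
move=> A T B bA bB [bT HT]; split=> [|e e0].
  exact: (bounded_op_comp qX qX _ _ (bounded_op_comp qX qX _ _ bB bT) bA).
have [C C0 AC] := bounded_op_ge0 qX _ bA.
have [D D0 BD] := bounded_op_ge0 qX _ bB.
have CD : 0 < C * D + 1 by rewrite ltr_wpDl // mulr_ge0.
have [T' [JT HT']] := HT _ (divr_gt0 e0 CD).
exists (fun x => A (T' (B x))); split; first by apply: (JM A T' B).
move=> x hx; have XB : X (B x) by apply bB.
have Xt : X (T (B x)) by apply bT.
have Xt' : X (T' (B x)) by apply (Jb _ JT).
rewrite -(bounded_op_sub _ _ _ bA Xt Xt').
apply: (le_trans (AC _ (qn_sub qX _ _ Xt Xt'))).
apply: (@le_trans _ _ (C * (e / (C * D + 1) * (D * nX x)))).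
  rewrite ler_wpM2l // (le_trans (HT' _ XB)) // ler_wpM2l ?BD //.
  by rewrite divr_ge0 ?ltW.
have -> : C * (e / (C * D + 1) * (D * nX x)) = (e * nX x * (C * D)) / (C * D + 1).
  by field; rewrite gt_eqF.
by rewrite ler_pdivrMr // ler_wpM2l ?lerDl // mulr_ge0 // ltW.
Qed.

(** * The square of l_p inside l_p, and operators factoring through l_p *)

(** The coordinate embeddings of l_p (+) l_p into l_p, on the even positions for [b = false] and the
    odd ones for [b = true]; [select b] is the corresponding coordinate projection. *)
Definition spread {R : realType} (b : bool) (y : nat -> R) : nat -> R :=
  fun k => if odd k == b then y k./2 else 0.

Definition select {R : realType} (b : bool) (y : nat -> R) : nat -> R :=
  fun k => y (b + k.*2)%N.

Lemma lp_sum_spread {R : realType} (p : R) b (y : nat -> R) N : p != 0 ->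
  \sum_(0 <= n < N.*2) `|spread b y n| `^ p = \sum_(0 <= n < N) `|y n| `^ p.
Proof.
move=> pn; elim: N => [|N IH]; first by rewrite !big_geq.
rewrite doubleS !big_nat_recr //= IH -addrA; congr (_ + _).
rewrite /spread /= odd_double doubleK uphalf_double.
by case: b {IH} => /=; rewrite normr0 powR0 // ?addr0 ?add0r.
Qed.

Lemma lp_sum_select {R : realType} (p : R) b (y : nat -> R) N :
  \sum_(0 <= n < N) `|select b y n| `^ p <= \sum_(0 <= n < N.*2) `|y n| `^ p.
Proof.
elim: N => [|N IH]; first by rewrite !big_geq.
rewrite doubleS !big_nat_recr //= -addrA lerD // /select.
by case: b {IH} => /=; rewrite ?add0n ?add1n ?lerDl ?lerDr powR_ge0.
Qed.

(** Comparing finite partial sums on both sides yields membership in l_p and the norm bound 1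
    together. *)
Lemma bounded_op_lp_contraction {R : realType} (p : R) (T : (nat -> R) -> nat -> R) :
  0 < p ->
  (forall (a : R) x y, T (fun k => a * x k + y k) = (fun k => a * T x k + T y k)) ->
  (forall y N, exists M,
     \sum_(0 <= n < N) `|T y n| `^ p <= \sum_(0 <= n < M) `|y n| `^ p) ->
  bounded_op (lp p) (lp_norm p) (lp p) (lp_norm p) T.
Proof.
move=> p0 Tl TN.
have H y : lp p y -> lp p (T y) /\ fine (lp_sum p (T y)) <= fine (lp_sum p y).
  move=> hy; apply: nneseries_le_of_partial => [n|N]; first exact: powR_ge0.
  have [M /le_trans] := TN y N; apply.
  by apply: (partial_le_nneseries _ M _ hy) => n; exact: powR_ge0.
split=> [x /H[]|]; first by [].
split; first by move=> a x y _ _; exact: Tl.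
exists 1 => y /H[_ h].
rewrite mul1r; apply: (ler_powR_base _ _ _ _ _ h); first by rewrite invr_ge0 ltW.
by rewrite fine_ge0 // nneseries_ge0 // => n _ _; rewrite lee_fin powR_ge0.
Qed.

Lemma bounded_op_spread {R : realType} (p : R) b : 0 < p ->
  bounded_op (lp p) (lp_norm p) (lp p) (lp_norm p) (spread b).
Proof.
move=> p0; apply: bounded_op_lp_contraction => // [a x y|y N].
  by apply/funext => k; rewrite /spread; case: ifP; rewrite // mulr0 addr0.
exists N; rewrite -(lp_sum_spread p b y) ?gt_eqF // -addnn.
rewrite [leRHS](@big_cat_nat _ _ _ N) ?leq_addr //=.
by rewrite lerDl sumr_ge0 // => i _; exact: powR_ge0.
Qed.

Lemma bounded_op_select {R : realType} (p : R) b : 0 < p ->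
  bounded_op (lp p) (lp_norm p) (lp p) (lp_norm p) (select b).
Proof.
move=> p0; apply: bounded_op_lp_contraction => // y N.
by exists N.*2; exact: lp_sum_select.
Qed.

Lemma select_spread {R : realType} (b : bool) (y z : nat -> R) :
  select b (fun k => spread b y k + spread (~~ b) z k) = y.
Proof.
apply/funext => k; rewrite /select /spread oddD odd_double addbF oddb eqxx.
by rewrite half_bit_double; case: b; rewrite addr0.
Qed.

(* The sum of two operators factoring through l_p factors through
   l_p (+) l_p, which is realised in l_p on the even and the odd positions. *)
Lemma op_ideal_factor_lp {R : realType} (w : nat -> R) (p : R) : 1 <= p ->
  quasi_norm (lorentz w p) (lorentz_norm w p) ->
  op_ideal (lorentz w p) (lorentz_norm w p) (factor_lp w p).
Proof.
move=> p1 qX; have p0 : 0 < p by exact: lt_le_trans p1.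
have qL := @quasi_norm_lp R p p1.
split; first by move=> T [].
split.
  split; first exact: bounded_op_zero.
  exists (fun _ _ => 0), (fun _ _ => 0); split; first exact: bounded_op_zero.
  by split=> //; exact: bounded_op_zero.
split.
  move=> S T [bS [A1 [B1 [bA1 [bB1 E1]]]]] [bT [A2 [B2 [bA2 [bB2 E2]]]]].
  split; first exact: bounded_op_add.
  exists (fun x k => spread false (A1 x) k + spread true (A2 x) k).
  exists (fun y k => B1 (select false y) k + B2 (select true y) k).
  split.
    apply: (bounded_op_add qL).
      exact: (bounded_op_comp qX qL _ _ bA1 (bounded_op_spread p false p0)).
    exact: (bounded_op_comp qX qL _ _ bA2 (bounded_op_spread p true p0)).
  split.
    apply: (bounded_op_add qX).
      exact: (bounded_op_comp qL qL _ _ (bounded_op_select p false p0) bB1).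
    exact: (bounded_op_comp qL qL _ _ (bounded_op_select p true p0) bB2).
  move=> x hx; rewrite (E1 x hx) (E2 x hx) (select_spread false (A1 x) (A2 x)).
  (* [select_spread] expects the selected summand first. *)
  have -> : (fun k => spread false (A1 x) k + spread true (A2 x) k) =
            (fun k => spread true (A2 x) k + spread (~~ true) (A1 x) k).
    by apply/funext => k; rewrite addrC.
  by rewrite select_spread.
split.
  move=> a T [bT [A [B [bA [bB E]]]]]; split; first exact: bounded_op_scale.
  exists A, (fun y k => a * B y k); split; first exact: bA.
  by split; [exact: bounded_op_scale | move=> x hx; rewrite (E x hx)].
move=> A0 T B0 bA0 bB0 [bT [A [B [bA [bB E]]]]]; split.
  exact: (bounded_op_comp qX qX _ _ (bounded_op_comp qX qX _ _ bB0 bT) bA0).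
exists (fun x => A (B0 x)), (fun y => A0 (B y)).
split; first exact: (bounded_op_comp qX qX _ _ bB0 bA).
split; first exact: (bounded_op_comp qL qX _ _ bB bA0).
by move=> x hx; rewrite (E _ (proj1 bB0 x hx)).
Qed.

(** * From the identity in the closure to an embedding into l_p *)

(** If B A is within 1/(2K) of the identity, then |x| <= K (|x - B A x| + |B A x|) <= |x|/2 + K (C +
    1) |A x|, where C bounds B, and the term |x|/2 is absorbed on the left. *)
Lemma id_closure_factor_lp {R : realType} (w : nat -> R) (p : R) : 1 <= p ->
  quasi_norm (lorentz w p) (lorentz_norm w p) ->
  op_closure (lorentz w p) (lorentz_norm w p) (factor_lp w p) id ->
  exists2 A, bounded_op (lorentz w p) (lorentz_norm w p) (lp p) (lp_norm p) A &
  exists2 c : R, 0 < c &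
    forall x, lorentz w p x -> c * lorentz_norm w p x <= lp_norm p (A x).
Proof.
move=> p1 qX [_ Hid]; have qL := @quasi_norm_lp R p p1.
have [K K0 HK] := qn_add_le qX.
have d0 : 0 < (2 * K)^-1 by rewrite invr_gt0 mulr_gt0.
have [S [[bS [A [B [bA [bB E]]]]] HS]] := Hid _ d0; exists A => //.
have [C C0 BC] := bounded_op_ge0 qL _ bB.
have KC : 0 < K * (C + 1) by rewrite mulr_gt0 // ltr_wpDl.
exists (2 * (K * (C + 1)))^-1; first by rewrite invr_gt0 mulr_gt0.
move=> x hx; have hSx : lorentz w p (S x) by apply bS.
have := HK _ _ (qn_sub qX _ _ hx hSx) hSx.
under eq_fun do rewrite subrK.
have h1 := HS x hx; rewrite /= in h1.
have h2 : lorentz_norm w p (S x) <= (C + 1) * lp_norm p (A x).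
  rewrite (E x hx); apply: (le_trans (BC _ (proj1 bA x hx))).
  by rewrite ler_wpM2r ?lerDl // (qn_ge0 _ _ qL).
move=> h3; rewrite mulrC ler_pdivrMr ?mulr_gt0 // ?ltr_wpDl //.
have h4 := lerD h1 h2; rewrite -(ler_pM2l K0) in h4.
have h5 := le_trans h3 h4.
set N := lorentz_norm w p x in h5 *; set L := lp_norm p (A x) in h5 *.
have E5 : K * ((2 * K)^-1 * N + (C + 1) * L) = 2^-1 * N + K * (C + 1) * L.
  by field; rewrite gt_eqF.
have -> : L * (2 * (K * (C + 1))) = 2 * (K * (C + 1) * L) by ring.
move: h5; rewrite E5; move: (K * (C + 1) * L) N {E5} => v n; clear => h.
by lra.
Qed.

(** * Adding nearly disjoint vectors in l_p *)

(** Only a lower bound for |b + t|^p is wanted, so it suffices to keep |b + t| above the number [r]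
    with r^p = |b|^p - e; the distance from [r] to |b| is the admissible size of t. *)
Lemma powR_lower_semicontinuous {R : realType} (p b e : R) : 0 < p -> 0 < e ->
  exists2 d : R, 0 < d & forall t, `|t| <= d ->
    `|b| `^ p - e <= `|b + t| `^ p /\ `|t| `^ p <= e.
Proof.
move=> p0 e0; have pn : p != 0 by rewrite gt_eqF.
suff [d d0 H] : exists2 d : R, 0 < d & forall t, `|t| <= d ->
    `|b| `^ p - e <= `|b + t| `^ p.
  exists (Num.min d (e `^ p^-1)); first by rewrite lt_min d0 powR_gt0.
  move=> t; rewrite le_min => /andP[td te]; split; first exact: H.
  by rewrite -[leRHS](powRVK p _ pn (ltW e0)) ler_powR_base // ltW.
have [be|be] := leP (`|b| `^ p) e.
  by exists 1 => // t _; rewrite (@le_trans _ _ 0) ?powR_ge0 // subr_le0.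
have g0 : 0 < `|b| `^ p - e by rewrite subr_gt0.
pose r := (`|b| `^ p - e) `^ p^-1.
have rE : r `^ p = `|b| `^ p - e by rewrite powRVK // ltW.
have rb : r < `|b|.
  rewrite ltNge; apply/negP => /(ler_powR_base p _ _ (ltW p0) (normr_ge0 b)).
  by rewrite rE; lra.
exists (`|b| - r) => [|t tb]; first by rewrite subr_gt0.
rewrite -rE; apply: ler_powR_base; [exact: ltW|exact: powR_ge0|].
by have := ler_normB (b + t) t; rewrite addrK; lra.
Qed.

Lemma powR_ge1 {R : realType} (p s : R) : 0 <= p -> 1 <= s -> 1 <= s `^ p.
Proof. by move=> p0 /(ler_powR_base p _ _ p0 ler01); rewrite powR1. Qed.

Lemma powR_le1 {R : realType} (p s : R) : 0 <= p -> 0 <= s -> s <= 1 -> s `^ p <= 1.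
Proof. by move=> p0 s0 /(ler_powR_base p _ _ p0 s0); rewrite powR1. Qed.

(** On a finite head a small [v] neither destroys the mass of [y] nor carries much mass itself; [d]
    is fixed before [v]. The induction halves [e] at each coordinate. *)
Lemma head_sum_perturb {R : realType} (p e : R) (y : nat -> R) (M : nat) :
  0 < p -> 0 < e ->
  exists2 d : R, 0 < d & forall v, (forall i, (i < M)%N -> `|v i| <= d) ->
    \sum_(0 <= i < M) `|y i| `^ p - e <= \sum_(0 <= i < M) `|y i + v i| `^ p /\
    \sum_(0 <= i < M) `|v i| `^ p <= e.
Proof.
move=> p0; elim: M e => [|M IH] e e0.
  by exists 1 => // v _; rewrite !big_geq // sub0r oppr_le0 ltW.
have e20 : 0 < e / 2 by rewrite divr_gt0.
have [d1 d10 H1] := IH _ e20.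
have [d2 d20 H2] := powR_lower_semicontinuous p (y M) (e / 2) p0 e20.
exists (Num.min d1 d2) => [|v vd]; first by rewrite lt_min d10.
have [] := H1 v.
  by move=> i iM; have := vd i (ltnW iM); rewrite le_min => /andP[].
have [] := H2 (v M).
  by have := vd M (ltnSn M); rewrite le_min => /andP[].
rewrite !big_nat_recr //=; move: (`|y M| `^ p) => a.
move: (`|y M + v M| `^ p) (`|v M| `^ p) => a' a''.
move: (\sum_(_ <= _ < _) _) (\sum_(_ <= _ < _) _) (\sum_(_ <= _ < _) _) => b b' b''.
by move=> *; split; lra.
Qed.

Lemma nneseries_partial_approx {R : realType} (u : nat -> R) (e : R) :
  (forall n, 0 <= u n) -> 0 < e ->
  exists M, fine (\sum_(0 <= n <oo) (u n)%:E)%E - e <= \sum_(0 <= n < M) u n.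
Proof.
move=> u0 e0; apply: contrapT => /forallNP H.
pose S := fine (\sum_(0 <= n <oo) (u n)%:E)%E.
have uS M : \sum_(0 <= n < M) u n <= S - e.
  by apply: ltW; rewrite ltNge; apply/negP; exact: H.
have [_] := nneseries_le_of_partial u _ u0 uS.
by rewrite -/S lerDl oppr_ge0 leNgt e0.
Qed.

Lemma lp_sum_ge0 {R : realType} (p : R) (y : nat -> R) : 0 <= fine (lp_sum p y).
Proof.
by rewrite fine_ge0 // nneseries_ge0 // => n _ _; rewrite lee_fin powR_ge0.
Qed.

Lemma lorentz_sum_ge0 {R : realType} (w : nat -> R) (p : R) (y : nat -> R) :
  (forall n, 0 <= w n) -> 0 <= fine (lorentz_sum w p y).
Proof.
move=> w0; rewrite fine_ge0 // nneseries_ge0 // => n _ _.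
by rewrite lee_fin mulr_ge0 // powR_ge0.
Qed.

(** Up to [M] the vector [v] is negligible and beyond [M] the vector [y] is, so the masses nearly
    add. Both [M] and [d] depend on [y] and [c] alone, which lets [v] be chosen afterwards. *)
Lemma lp_sum_add_ge {R : realType} (p c : R) (y : nat -> R) :
  0 < p -> 0 < c -> lp p y ->
  exists M, exists2 d : R, 0 < d & forall v,
    (forall i, (i < M)%N -> `|v i| <= d) -> lp p v -> c <= fine (lp_sum p v) ->
    lp p (fun i => y i + v i) ->
    fine (lp_sum p y) + c / (2 * 2 `^ p) <= fine (lp_sum p (fun i => y i + v i)).
Proof.
move=> p0 c0 hy; pose K : R := 2 `^ p.
have K1 : 1 <= K.
  by apply: powR_ge1; [exact: ltW | rewrite ler1n].
have K0 : 0 < K by exact: lt_le_trans K1.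
(* So c = 10 K e. The tail of [v] keeps at least c - 2e >= 8 K e; dividing by K and removing the
   tail of [y] leaves 7e for the tail of [y + v]. The head loses at most 2e, so the gain is 5e =
   c/(2K). *)
pose e := c / (10 * K).
have e0 : 0 < e by rewrite divr_gt0 // mulr_gt0.
have cE : c = 10 * (K * e) by rewrite /e; field; rewrite gt_eqF.
have pow0 (z : nat -> R) n : 0 <= `|z n| `^ p by exact: powR_ge0.
have [M HM] := nneseries_partial_approx _ e (pow0 y) e0.
have [d d0 Hd] := head_sum_perturb p e y M p0 e0.
exists M, d => // v vd hv vc hyv; have [h1 h2] := Hd v vd.
have [N HN] := nneseries_partial_approx _ e (pow0 v) e0.
have cat (z : nat -> R) : \sum_(0 <= i < M + N) `|z i| `^ p =
    \sum_(0 <= i < M) `|z i| `^ p + \sum_(M <= i < M + N) `|z i| `^ p.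
  by rewrite (@big_cat_nat _ _ _ M) ?leq_addr.
have h3 : \sum_(0 <= i < N) `|v i| `^ p <= \sum_(0 <= i < M + N) `|v i| `^ p.
  rewrite addnC [leRHS](@big_cat_nat _ _ _ N) ?leq_addr //=.
  by rewrite lerDl sumr_ge0.
have h4 := partial_le_nneseries _ (M + N) (pow0 y) hy.
have h5 := partial_le_nneseries _ (M + N) (pow0 (fun i => y i + v i)) hyv.
(* On the tail, [v] is written as (y + v) - y, which bounds the mass of [y + v] from below. *)
have h6 : \sum_(M <= i < M + N) `|v i| `^ p <=
    K * (\sum_(M <= i < M + N) `|y i + v i| `^ p + \sum_(M <= i < M + N) `|y i| `^ p).
  rewrite -big_split mulr_sumr /= ler_sum // => i _.
  have := normD_powR_le p (y i + v i) (- y i) (ltW p0).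
  by rewrite normrN addrAC subrr add0r.
rewrite !cat in h3 h4 h5.
have -> : c / (2 * 2 `^ p) = 5 * e by rewrite /e -/K; field; rewrite gt_eqF.
rewrite -/(lp_sum p y) in HM h4; rewrite -/(lp_sum p v) in HN.
rewrite -/(lp_sum p _) in h5.
move: h1 h2 h3 h4 h5 h6 HM HN vc; rewrite cE.
move: (fine (lp_sum p y)) (fine (lp_sum p v)) (fine (lp_sum p _)) => sy sv s.
move: (\sum_(0 <= i < M) `|y i| `^ p) (\sum_(M <= i < M + N) `|y i| `^ p) => a1 a2.
move: (\sum_(0 <= i < M) `|v i| `^ p) (\sum_(M <= i < M + N) `|v i| `^ p) => v1 v2.
move: (\sum_(0 <= i < M) _) (\sum_(M <= i < M + N) _) (\sum_(0 <= i < N) _) => d1 d2 v3.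
move: K0 K1 e0; move: (K) (e); clear => k f k0 k1 f0 h1 h2 h3 h4 h5 h6 HM HN vc.
have kf : f <= k * f by rewrite ler_peMl // ltW.
have : k * (8 * f) <= k * (d2 + a2) by lra.
by rewrite ler_pM2l // => ?; lra.
Qed.

(** * Choice of a difference with small coordinates *)

(** Rounding the first M coordinates to cells of width d leaves finitely many codes, so two of
    sufficiently many indices from L on share a code, and then each coordinate differs by at most
    d. *)
Lemma pigeonhole_coordinates {R : realType} (a : nat -> nat -> R) (B d : R) (M L : nat) :
  0 < d -> (forall n i, `|a n i| <= B) ->
  exists n m, [/\ (L <= n)%N, (n < m)%N &
    forall i, (i < M)%N -> `|a n i - a m i| <= d].
Proof.
move=> d0 aB.
pose q n i := Num.truncn ((a n i + B) / d).
have ab0 n i : 0 <= (a n i + B) / d.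
  by rewrite divr_ge0 ?(ltW d0) //; have := aB n i; rewrite ler_norml => /andP[]; lra.
pose Q := Num.truncn ((B + B) / d).
have qQ n i : (q n i <= Q)%N.
  apply: le_truncn; rewrite ler_pM2r ?invr_gt0 // lerD2r.
  exact: le_trans (ler_norm _) (aB n i).
(* One index more than there are codes; [inord] loses nothing because [q] is at most [Q]. *)
pose code (n : 'I_(#|{ffun 'I_M -> 'I_Q.+1}|.+1)) : {ffun 'I_M -> 'I_Q.+1} :=
  [ffun i : 'I_M => inord (q (L + n)%N i)].
have /injectivePn[n [m nm codenm]] : ~~ injectiveb code.
  by apply/negP => /injectiveP/leq_card; rewrite card_ord ltnn.
wlog ltnm : n m nm codenm / (n < m)%N => [H|].
  have := nm; rewrite neq_ltn => /orP[|] lt; first exact: H lt.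
  by apply: H lt; rewrite // eq_sym.
exists (L + n)%N, (L + m)%N; split; rewrite ?leq_addr ?ltn_add2l // => i iM.
have := congr1 (fun f : {ffun 'I_M -> 'I_Q.+1} => val (f (Ordinal iM))) codenm.
rewrite !ffunE /= !inordK ?ltnS ?qQ // => E.
have /andP[l1 u1] := truncn_itv (ab0 (L + n)%N i).
have /andP[l2 u2] := truncn_itv (ab0 (L + m)%N i).
rewrite -/(q _ _) in l1 u1; rewrite -/(q _ _) -E in l2 u2.
rewrite -!natr1 in u1 u2.
have -> : a (L + n)%N i - a (L + m)%N i =
    ((a (L + n)%N i + B) / d - (a (L + m)%N i + B) / d) * d.
  by field; rewrite gt_eqF.
rewrite normrM (gtr0_norm d0) -[leRHS]mul1r ler_pM2r // ler_norml.
by apply/andP; split; lra.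
Qed.

(** * Lorentz norms of finitely supported sequences *)

Section FinitelySupported.
Context {R : realType} (w : nat -> R) (p : R).
Hypotheses (p0 : 0 < p) (w0 : forall n, 0 <= w n).

(** The rearrangement is at most 1 everywhere, and it vanishes from index n on because F is an
    exceptional set for the level 0. *)
Lemma lorentz_finite (x : nat -> R) (F : seq nat) (n : nat) :
  (size F <= n)%N -> (forall k, `|x k| <= 1) -> (forall k, x k != 0 -> k \in F) ->
  lorentz w p x /\ fine (lorentz_sum w p x) <= \sum_(0 <= i < n) w i.
Proof.
move=> Fn x1 xF.
have [hfin hle] : (lorentz_sum w p x < +oo)%E /\
    fine (lorentz_sum w p x) <= \sum_(0 <= i < n) w i.
  apply: nneseries_le_of_partial => [i|N]; first by rewrite mulr_ge0 // powR_ge0.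
  apply: (@le_trans _ _ (\sum_(0 <= i < n + N) w i * decr_rearr x i `^ p)).
    rewrite addnC [leRHS](@big_cat_nat _ _ _ N) ?leq_addr //=.
    by rewrite lerDl sumr_ge0 // => i _; rewrite mulr_ge0 // powR_ge0.
  rewrite (@big_cat_nat _ _ _ n) ?leq_addr //=.
  have -> : \sum_(n <= i < n + N) w i * decr_rearr x i `^ p = 0.
    rewrite big_nat big1 // => i /andP[ni _]; have -> : decr_rearr x i = 0.
      apply/eqP; rewrite eq_le decr_rearr_ge0 andbT.
      apply: (decr_rearr_le _ _ _ F) => //; first exact: leq_trans ni.
      by move=> k; rewrite normr_gt0; exact: xF.
    by rewrite powR0 ?mulr0 // gt_eqF.
  rewrite addr0 ler_sum // => i _; rewrite ler_piMr //.
  apply: powR_le1; rewrite ?decr_rearr_ge0 ?(ltW p0) //.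
  by apply: (decr_rearr_le _ _ _ [::]) => // k; rewrite ltNge x1.
split=> //; split=> //; apply/cvgr0Pnorm_le => e e0.
exists (\max_(i <- F) i).+1 => // k /= Fk.
have [->|/xF kF] := eqVneq (x k) 0; first by rewrite normr0 ltW.
have := @leq_bigmax_seq _ F xpredT id k kF isT.
by move=> /leq_ltn_trans/(_ Fk); rewrite ltnn.
Qed.

Lemma lorentz_sum_ge1 (x : nat -> R) (k : nat) : w 0%N = 1 ->
  lorentz w p x -> `|x k| = 1 -> 1 <= fine (lorentz_sum w p x).
Proof.
move=> w01 [/cvg0_bounded[M xM] hfin] xk.
have wp0 n : 0 <= w n * decr_rearr x n `^ p by rewrite mulr_ge0 // powR_ge0.
apply: le_trans (partial_le_nneseries _ 1 wp0 hfin).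
rewrite big_nat1 w01 mul1r; apply: powR_ge1; first exact: ltW.
by rewrite -xk; exact: norm_le_decr_rearr0 xM.
Qed.

End FinitelySupported.

(** * Averages of a null sequence *)

(** Means of a null sequence tend to 0. Beyond some n0 each weight is at most e = c/(4(D + 1)), so
    these terms account for at most N c/2 of the right-hand side; what remains forces N <= 2 D n0/c
    for every N. *)
Lemma cvg0_not_average_ge {R : realType} (w : nat -> R) (c D : R) :
  w @ \oo --> (0 : R) -> (forall n, w n <= 1) -> 0 < c -> 0 <= D ->
  ~ (forall N : nat, N%:R * c <= D * \sum_(0 <= i < N + N) w i).
Proof.
move=> wc w1 c0 D0 H.
have D1 : 0 < 4 * (D + 1) by rewrite mulr_gt0 // ltr_wpDl.
pose e := c / (4 * (D + 1)); have e0 : 0 < e by rewrite divr_gt0.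
have [n0 _ Hn0] := (cvgr0Pnorm_le _).1 wc e e0.
have sumw K : \sum_(0 <= i < K) w i <= n0%:R + K%:R * e.
  elim: K => [|K IH]; first by rewrite big_geq // mul0r addr0.
  have [Kn|nK] := ltnP K n0; last first.
    rewrite big_nat_recr //= -[K.+1]addn1 natrD mulrDl mul1r addrA lerD //.
    exact: le_trans (ler_norm _) (Hn0 K nK).
  apply: (@le_trans _ _ n0%:R); last by rewrite lerDl mulr_ge0 // ltW.
  apply: (@le_trans _ _ (\sum_(0 <= i < K.+1) 1)); first exact: ler_sum.
  by rewrite big_const_nat iter_addr_0 subn0 ler_nat.
have bound N : N%:R <= 2 * D * n0%:R / c.
  rewrite ler_pdivlMr //.
  have h := le_trans (H N) (ler_wpM2l D0 (sumw (N + N)%N)).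
  rewrite natrD in h.
  have h' : D * ((N%:R + N%:R) * e) <= N%:R * c / 2.
    have -> : N%:R * c / 2 = (D + 1) * ((N%:R + N%:R) * e).
      by rewrite /e; field; rewrite gt_eqF // ltr_wpDl.
    by rewrite ler_wpM2r ?lerDl // mulr_ge0 ?addr_ge0 // ltW.
  rewrite mulrDr in h; rewrite -mulrA; move: h h'.
  by move: (D * (_ * e)) (N%:R * c) (D * n0%:R) => u v z; lra.
have := bound (Num.truncn (2 * D * n0%:R / c)).+1.
by rewrite leNgt truncnS_gt.
Qed.

Lemma nonincreasing_cvg0_ge0 {R : realType} (w : nat -> R) :
  (forall n, w n.+1 <= w n) -> w @ \oo --> (0 : R) -> forall n, 0 <= w n.
Proof.
move=> wd wc n; rewrite -(cvg_lim _ wc) //.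
by apply: nonincreasing_cvgn_ge; [exact/nonincreasing_seqP | exact: cvgP wc].
Qed.

(** * No embedding of the Lorentz space into l_p *)

Definition unit_seq {R : realType} (i : nat) : nat -> R := fun k => (k == i)%:R.

Section NoEmbedding.
Context {R : realType} {w : nat -> R} {p c : R} {A : (nat -> R) -> nat -> R}.
Hypotheses (p1 : 1 <= p) (w01 : w 0%N = 1) (wd : forall n, w n.+1 <= w n).
Hypothesis wc : w @ \oo --> (0 : R).
Hypothesis bA : bounded_op (lorentz w p) (lorentz_norm w p) (lp p) (lp_norm p) A.
Hypotheses (c0 : 0 < c)
  (cA : forall x, lorentz w p x -> c * lorentz_norm w p x <= lp_norm p (A x)).

Let p0 : 0 < p. Proof. exact: lt_le_trans p1. Qed.
Let pn : p != 0. Proof. by rewrite gt_eqF. Qed.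

Let w0 n : 0 <= w n. Proof. exact: nonincreasing_cvg0_ge0. Qed.

Let w1 n : w n <= 1.
Proof. by rewrite -w01; move: (leq0n n); move: 0%N n; apply/nonincreasing_seqP. Qed.

Lemma lp_sum_op_bounded : exists2 D : R, 0 <= D & forall x, lorentz w p x ->
  fine (lp_sum p (A x)) <= D * fine (lorentz_sum w p x).
Proof.
have [C C0 CA] := bounded_op_ge0 (quasi_norm_lorentz w p p1 wd w0) _ bA.
exists (C `^ p) => [|x hx]; first exact: powR_ge0.
rewrite -(powRVK p _ pn (lp_sum_ge0 p (A x))).
rewrite -(powRVK p _ pn (lorentz_sum_ge0 w p x w0)) -powRM ?powR_ge0 //.
by apply: ler_powR_base; [exact: ltW | exact: powR_ge0 | exact: CA].
Qed.

(* Coordinatewise the images of the unit vectors are bounded, so some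
   difference [e_m - e_n] has an image that is negligible on any given finite
   set of coordinates; adding it to [z] increases |A z|^p by a fixed amount. *)
Lemma lp_sum_linear_growth : exists2 d : R, 0 < d & forall N : nat,
  exists z, [/\ forall k, `|z k| <= 1,
    exists2 F, (size F <= N + N)%N & forall k, z k != 0 -> k \in F,
    exists L, forall k, (L <= k)%N -> z k = 0 &
    N%:R * d <= fine (lp_sum p (A z))].
Proof.
have [D D0 DA] := lp_sum_op_bounded.
have [AX [Alin _]] := bA.
(* The gain of [lp_sum_add_ge] for a vector of p-th power mass at least c^p. *)
exists (c `^ p / (2 * 2 `^ p)) => [|N].
  by rewrite divr_gt0 ?mulr_gt0 ?powR_gt0.
have cp0 : 0 < c `^ p by rewrite powR_gt0.
elim: N => [|N [z [z1 [F FN zF] [L zL] Hz]]].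
  exists (fun=> 0); split=> [k|||]; rewrite ?normr0 ?mul0r ?lp_sum_ge0 //.
    by exists [::] => // k; rewrite eqxx.
  by exists 0%N.
have [hz _] := lorentz_finite w p p0 w0 z F _ FN z1 zF.
have [M [d d0 HM]] := lp_sum_add_ge p (c `^ p) (A z) p0 cp0 (AX z hz).
have he n : lorentz w p (unit_seq n) /\ fine (lorentz_sum w p (unit_seq n)) <= 1.
  have := lorentz_finite w p p0 w0 (unit_seq n) [:: n] 1 isT.
  rewrite big_nat1 w01; apply=> k; rewrite /unit_seq.
    by case: eqP; rewrite ?normr0 ?normr1.
  by rewrite inE; case: (eqVneq k n); rewrite ?eqxx.
have aB n i : `|A (unit_seq n) i| <= D `^ p^-1.
  rewrite -(powRK p _ pn (normr_ge0 (A _ i))).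
  apply: ler_powR_base; rewrite ?invr_ge0 ?(ltW p0) ?powR_ge0 //.
  have [hn en] := he n.
  apply: (@le_trans _ _ (D * 1)); last by rewrite mulr1.
  apply: le_trans (ler_wpM2l D0 en); apply: le_trans (DA _ hn).
  apply: le_trans (partial_le_nneseries (fun k => `|A (unit_seq n) k| `^ p) i.+1 _ _).
  - by rewrite big_nat_recr //= lerDr sumr_ge0 // => j _; exact: powR_ge0.
  - by move=> j; exact: powR_ge0.
  - exact: (AX _ hn).
have [n [m [Ln nm Hnm]]] :=
  pigeonhole_coordinates (fun n => A (unit_seq n)) _ d M L d0 aB.
(* The form -1 * e_m + e_n matches the linearity clause of [bounded_op]. *)
pose u : nat -> R := fun k => -1 * unit_seq m k + unit_seq n k.
have uE k : u k = (k == n)%:R - (k == m)%:R by rewrite /u /unit_seq mulN1r addrC.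
have u1 k : `|u k| <= 1.
  rewrite uE; case: eqP => [->|_]; last by case: eqP; rewrite sub0r normrN ?normr0 ?normr1.
  by rewrite ltn_eqF // subr0 normr1.
have uF k : u k != 0 -> k \in [:: n; m].
  by rewrite uE !inE; case: (eqVneq k n) => //=; case: (eqVneq k m) => //=; rewrite subrr eqxx.
have [hu _] := lorentz_finite w p p0 w0 u [:: n; m] 2 isT u1 uF.
have Au : A u = (fun k => -1 * A (unit_seq m) k + A (unit_seq n) k).
  by apply: Alin; [exact: (he m).1 | exact: (he n).1].
(* An entry of absolute value 1 gives [u] norm at least 1, and the embedding bounds |A u| below by
   c. *)
have Auc : c `^ p <= fine (lp_sum p (A u)).
  rewrite -(powRVK p _ pn (lp_sum_ge0 p (A u))).
  apply: ler_powR_base; [exact: ltW | exact: ltW |].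
  apply: le_trans (cA u hu); rewrite ler_peMr ?(ltW c0) //.
  apply: powR_ge1; first by rewrite invr_ge0 ltW.
  apply: (lorentz_sum_ge1 w p p0 w0 u n w01 hu).
  by rewrite uE eqxx ltn_eqF // subr0 normr1.
have Azu : A (fun k => 1 * z k + u k) = (fun k => A z k + A u k).
  by rewrite (Alin 1 z u hz hu); apply/funext => k; rewrite mul1r.
have zu0 k : (z k == 0) || (u k == 0).
  have [Lk|kL] := leqP L k; first by rewrite zL ?eqxx.
  rewrite uE !ltn_eqF ?subrr ?eqxx ?orbT //; last exact: leq_trans kL Ln.
  exact: leq_trans kL (ltnW (leq_ltn_trans Ln nm)).
exists (fun k => 1 * z k + u k); split=> [k|||].
- by have /orP[/eqP->|/eqP->] := zu0 k; rewrite ?mulr0 ?add0r ?addr0 ?mul1r.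
- exists (F ++ [:: n; m]); first by rewrite size_cat /= addnS addn1 addSn addnS !ltnS.
  move=> k; rewrite mem_cat; have [z0|/zF->//] := eqVneq (z k) 0.
  by rewrite z0 mulr0 add0r => /uF ->; rewrite orbT.
- exists (maxn L m.+1) => k; rewrite geq_max => /andP[Lk mk].
  by rewrite zL // uE (gtn_eqF mk) (gtn_eqF (ltn_trans nm mk)) subrr mulr0 addr0.
rewrite Azu -natr1 mulrDl mul1r.
apply: (@le_trans _ _ (fine (lp_sum p (A z)) + c `^ p / (2 * 2 `^ p))).
  by rewrite lerD2r.
apply: HM => // [i iM||].
- by rewrite Au mulN1r addrC; exact: Hnm.
- exact: AX.
- by rewrite -Azu; apply: AX; apply: (qn_lin _ _ (quasi_norm_lorentz w p p1 wd w0)).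
Qed.

Lemma lorentz_not_embedded_in_lp : False.
Proof.
have [D D0 DA] := lp_sum_op_bounded.
have [d d0 Hd] := lp_sum_linear_growth.
apply: (@cvg0_not_average_ge _ w d D wc w1 d0 D0) => N.
have [z [z1 [F FN zF] _ Nz]] := Hd N.
have [hz zw] := lorentz_finite w p p0 w0 z F _ FN z1 zF.
by apply: (le_trans Nz); apply: (le_trans (DA z hz)); rewrite ler_wpM2l.
Qed.

End NoEmbedding.

(** * Properness of both ideals, witnessed by the identity *)

Theorem theorem2p3 (R : realType) (p : R) (w : nat -> R) :
  1 <= p ->
  w 0%N = 1 ->
  (forall n, w n.+1 <= w n) ->
  w @ \oo --> (0 : R) ->
  (\sum_(0 <= n <oo) (w n)%:E = +oo)%E ->
  proper_op_ideal (lorentz w p) (lorentz_norm w p) (factor_lp w p) /\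
  proper_op_ideal (lorentz w p) (lorentz_norm w p)
    (op_closure (lorentz w p) (lorentz_norm w p) (factor_lp w p)).
Proof.
move=> p1 w01 wd wc _.
have w0 := nonincreasing_cvg0_ge0 w wd wc.
have qX := quasi_norm_lorentz w p p1 wd w0.
have idJ := op_ideal_factor_lp w p p1 qX.
have bid : bounded_op (lorentz w p) (lorentz_norm w p) (lorentz w p) (lorentz_norm w p) id.
  exact: bounded_op_id.
have nid : ~ op_closure (lorentz w p) (lorentz_norm w p) (factor_lp w p) id.
  move=> /(id_closure_factor_lp w p p1 qX)[A bA [c c0 cA]].
  exact: (lorentz_not_embedded_in_lp p1 w01 wd wc bA c0 cA).
split; split.
- exact: idJ.
- exists id; split=> [|idf]; first exact: bid.
  (* If the identity factored through l_p, it would lie in the closure as its own approximant. *)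
  apply: nid; split=> [|e e0]; first exact: bid.
  exists id; split=> [|x hx]; first exact: idf.
  under eq_fun do rewrite subrr.
  by rewrite (qn_norm0 _ _ qX) mulr_ge0 ?(ltW e0) // (qn_ge0 _ _ qX).
- exact: (op_ideal_closure _ _ _ qX idJ).
- by exists id; split; [exact: bid | exact: nid].
Qed.
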